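(* A Banach space $X$ is a Gurariy space if and only if it is an almost isometric ideal in every superspace in which it embeds as a hyperplane, that is, in every Banach space $Z$ containing $X$ (isometrically) as a closed linear subspace of codimension one.
   Context: Let $X, Y$ be Banach spaces and $\varepsilon>0$. A linear operator $T: X\to Y$ is an $\varepsilon$-isometry if $(1+\varepsilon)^{-1}\|x\|\le \|T(x)\|\le (1+\varepsilon)\|x\|$ for all $x\in X$. A Banach space $X$ is a Gurariy space if for every $\varepsilon>0$ and every pair of finite dimensional normed spaces $E\subseteq F$, every linear isometry (into) $T:E\to X$ extends to an $\varepsilon$-isometry $\widetilde{T}:F\to X$. A closed linear subspace $Y$ of a Banach space $X$ is an almost isometric ideal (a.i.-ideal) in $X$ if for every $\varepsilon>0$ and every finite dimensional subspace $E\subseteq X$ there exists a linear operator $T:E\to Y$ such that $Te=e$ for all $e\in Y\cap E$ and $T$ is an $\varepsilon$-isometry. *)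

(* Defs.v *)
From HB Require Import structures.
From mathcomp Require Import all_boot all_order all_algebra.
From mathcomp Require Import all_classical all_reals all_analysis.
From mathcomp Require Export complex.

Set Implicit Arguments.
Unset Strict Implicit.
Unset Printing Implicit Defensive.

Import Order.TTheory GRing.Theory Num.Theory.
Import numFieldNormedType.Exports.

Local Open Scope classical_set_scope.
Local Open Scope ring_scope.

(* Everything is stated over a numFieldType K so that K can be a realType R or
   R[i].  Norms are then K-valued; in R[i] the relation x <= y means that y - x
   is a nonnegative real, so 0 < eps forces eps to be real. *)

(* The set E is a linear subspace of V. *)
Definition subspace (K : numFieldType) (V : lmodType K) (E : set V) : Prop :=
  submod_closed [in E].

(* E is the linear span of finitely many vectors; in particular a subspace. *)
Definition finite_dimensional (K : numFieldType) (V : lmodType K)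
    (E : set V) : Prop :=
  exists (n : nat) (b : 'I_n -> V),
    E = [set x | exists c : 'I_n -> K, x = \sum_(i < n) c i *: b i].

(* dim (V / Y) = 1: the class of some v is nonzero and spans V / Y. *)
Definition codimension_one (K : numFieldType) (V : lmodType K)
    (Y : set V) : Prop :=
  exists2 v : V, ~ Y v & forall x : V, exists a : K, Y (x - a *: v).

(* An operator whose domain is a subspace E of V is encoded as a function on V
   of which only the values on E matter. *)
Definition linear_on (K : numFieldType) (V W : lmodType K) (E : set V)
    (T : V -> W) : Prop :=
  forall (a : K) (x y : V), E x -> E y -> T (a *: x + y) = a *: T x + T y.

Definition isometry_on (K : numFieldType) (V W : normedModType K) (E : set V)
    (T : V -> W) : Prop :=
  forall x : V, E x -> `|T x| = `|x|.

Definition eps_isometry_on (K : numFieldType) (V W : normedModType K) (eps : K)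
    (E : set V) (T : V -> W) : Prop :=
  forall x : V, E x ->
    (1 + eps)^-1 * `|x| <= `|T x| /\ `|T x| <= (1 + eps) * `|x|.

Definition gurariy (K : numFieldType) (X : completeNormedModType K) : Prop :=
  forall (eps : K) (F : normedModType K) (E : set F) (T : F -> X),
    0 < eps -> finite_dimensional [set: F] -> subspace E ->
    linear_on E T -> isometry_on E T ->
    exists T' : {linear F -> X},
      (forall e : F, E e -> T' e = T e) /\ eps_isometry_on eps [set: F] T'.

Definition ai_ideal (K : numFieldType) (Z : completeNormedModType K)
    (Y : set Z) : Prop :=
  [/\ closed Y, subspace Y &
    forall (eps : K) (E : set Z), 0 < eps -> finite_dimensional E ->
      exists T : Z -> Z,
        [/\ linear_on E T,
            forall e : Z, E e -> Y (T e),
            forall e : Z, Y e -> E e -> T e = e &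
            eps_isometry_on eps E T]].

(* The superspaces of X are represented by the linear isometric embeddings
   J : X -> Z; the copy of X inside Z is range J. *)
Definition ai_ideal_in_hyperplane_superspaces (K : numFieldType)
    (X : completeNormedModType K) : Prop :=
  forall (Z : completeNormedModType K) (J : {linear X -> Z}),
    isometry_on [set: X] J -> closed (range J) -> codimension_one (range J) ->
    ai_ideal (range J).

(* Main.v *)
Require Import Defs.
From HB Require Import structures.
From mathcomp Require Import all_boot all_order all_algebra.
From mathcomp Require Import all_classical all_reals all_analysis.
From mathcomp Require Import ring lra.
(* Restores [subspace] of Defs over its homonym in mathcomp-analysis. *)
Import Defs.

(** If X is a Gurariy space and J : X -> Z an isometric embedding, the partial
    inverse of J on E meet J X, for a finite-dimensional E in Z, extends to an
    eps-isometry E -> X, and composing with J shows that J X is an a.i.-ideal.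

    Conversely, let E be a subspace of a finite-dimensional F, T : E -> X an
    eps-isometry and v a vector outside E.  On X (+) K v put
      N (x, a) = inf over e in E of |x + T e| + (1 + eps) |a v - e|,
    the quotient norm on X (+) F modulo the graph of -T.  It is a complete norm,
    it extends the norm of X because |T e| <= (1 + eps) |e|, and it makes the
    map e + a v |-> (T e, a) an eps-isometry on E + K v.  As X is an a.i.-ideal
    in this hyperplane superspace, T extends to an eps'-isometry E + K v -> X
    for each eps' > eps.  Since T is only required to be an eps-isometry, the
    step can be repeated until F is exhausted. *)

Set Implicit Arguments.
Unset Strict Implicit.
Unset Printing Implicit Defensive.

Import Order.TTheory GRing.Theory Num.Theory.
Import numFieldNormedType.Exports.

Local Open Scope classical_set_scope.
Local Open Scope ring_scope.

(** * Completeness and infima in the scalar fields R and R[i] *)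

Section ScalarField.
Variable K : numFieldType.

Definition complete_field : Prop :=
  forall G : set_system K, ProperFilter G -> cauchy_ex G ->
  exists l : K, G --> l.

(** Over R[i] the order is only partial, but a set of elements above 0 consists of reals, so infima
    still make sense. *)
Definition has_infima : Prop :=
  forall A : set K, A !=set0 -> (forall x, A x -> 0 <= x) ->
  exists m : K, (forall x, A x -> m <= x) /\
    (forall l, (forall x, A x -> l <= x) -> l <= m).

End ScalarField.

Lemma real_has_infima (R : realType) : has_infima R.
Proof.
move=> A [a Aa] A0; exists (inf A); split.
  by move=> x Ax; apply: ge_inf => //; exists 0 => y /A0.
by move=> l Al; apply: lb_le_inf => //; exists a.
Qed.

Lemma real_complete_field (R : realType) : complete_field R.
Proof. by move=> G GF /cauchyP /R_complete /cvg_ex. Qed.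

Lemma complex_has_infima (R : realType) : has_infima (R[i])%C.
Proof.
move=> A [a Aa] A0.
have A0E x : A x -> (0 <= complex.Re x) /\ x = (complex.Re x)%:C%C.
  move=> /A0; rewrite lecE /= => /andP[/eqP x1 x0]; split=> //.
  by case: x x1 {x0} => x y /= ->.
have ReA0 : [set complex.Re x | x in A] !=set0 by exists (complex.Re a), a.
have ReA_ge0 r : [set complex.Re x | x in A] r -> 0 <= r.
  by move=> [x /A0E[x0 _] <-].
have [m [mA Am]] := real_has_infima ReA0 ReA_ge0.
exists (m%:C)%C; split=> [x Ax|l lA].
  have [_ ->] := A0E _ Ax; rewrite lecR; apply: mA.
  by exists x.
(* A lower bound lies below the real number [a], hence is itself real. *)
have := lA _ Aa; have [_ {1}->] := A0E _ Aa.
rewrite lecE /= => /andP[/eqP l0 _]; rewrite lecE /= l0 eqxx /=.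
apply: Am => _ [x Ax <-].
by have := lA _ Ax; rewrite lecE => /andP[].
Qed.

(** Real and imaginary parts are 1-Lipschitz, so they carry a Cauchy filter to convergent real
    filters, whose limits are the two parts of the complex limit. *)
Lemma complex_complete_field (R : realType) : complete_field (R[i])%C.
Proof.
move=> G GF GC.
have contr (f : (R[i])%C -> R) :
    (forall x y, (`|f x - f y|%:C <= `|x - y|)%C) -> exists l : R, f @ G --> l.
  move=> fP; apply: real_complete_field => e e0.
  have eC0 : (0 < e%:C :> R[i])%C by rewrite ltcR.
  have [x Gx] := GC _ eC0.
  exists (f x); apply: (@filterS _ G) Gx => y; rewrite /ball /= => xy.
  by rewrite -ltcR; apply: le_lt_trans (fP _ _) xy.
have [|a Ga] := contr (@complex.Re R).
  by move=> x y; rewrite -raddfB; exact: normc_ge_Re.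
have [|b Gb] := contr (@complex.Im R).
  move=> x y; rewrite -raddfB.
  by rewrite normc_def lecR -sqrtr_sqr ler_sqrt ?lerDr ?addr_ge0 ?sqr_ge0.
exists (a +i* b)%C; apply/cvgrPdist_lt => e.
rewrite ltcE /= => /andP[/eqP e1 e0].
have -> : e = ((complex.Re e)%:C)%C by case: e e1 {e0} => x y /= ->.
set d := complex.Re e in e0 *.
have d2 : 0 < d / 2 by rewrite divr_gt0.
move/cvgrPdist_lt/(_ _ d2) : Ga => Ga; move/cvgrPdist_lt/(_ _ d2) : Gb => Gb.
near=> z.
have xP : `|a - complex.Re z| < d / 2 by near: z.
have yP : `|b - complex.Im z| < d / 2 by near: z.
rewrite normc_def ltcR.
have -> : complex.Re ((a +i* b)%C - z) = a - complex.Re z by case: (z).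
have -> : complex.Im ((a +i* b)%C - z) = b - complex.Im z by case: (z).
rewrite -(@ltr_pXn2r _ 2) ?nnegrE ?sqrtr_ge0 ?(ltW e0)//.
rewrite sqr_sqrtr ?addr_ge0 ?sqr_ge0// -(real_normK (num_real (a - _))).
rewrite -(real_normK (num_real (b - _))).
have := normr_ge0 (a - complex.Re z); have := normr_ge0 (b - complex.Im z).
nra.
Unshelve. all: by end_near. Qed.

(** * Linear algebra of subspaces and of maps linear on a subspace *)

Lemma lift_max_widen n (i : 'I_n) : lift ord_max i = widen_ord (leqnSn n) i.
Proof. by apply: val_inj; rewrite /= /bump leqNgt ltn_ord. Qed.

Section LinearAlgebra.
Variables (K : numFieldType) (V : lmodType K).
Implicit Types E : set V.

Lemma subspaceP E :
  subspace E <-> E 0 /\ forall a x y, E x -> E y -> E (a *: x + y).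
Proof.
split=> [[E0 El]|[E0 El]]; split; rewrite ?inE//.
- by move: E0; rewrite inE.
- by move=> a x y Ex Ey; have := El a x y; rewrite !inE; apply.
- by move=> a x y; rewrite !inE; exact: El.
Qed.

Lemma subspace0 E : subspace E -> E 0.
Proof. by case/subspaceP. Qed.

Lemma subspaceD E x y : subspace E -> E x -> E y -> E (x + y).
Proof. by move=> /subspaceP[_ El] Ex Ey; rewrite -[x]scale1r; exact: El. Qed.

Lemma subspaceZ E a x : subspace E -> E x -> E (a *: x).
Proof.
by move=> /subspaceP[E0 El] Ex; rewrite -[_ *: _]addr0; exact: El.
Qed.

Lemma subspaceB E x y : subspace E -> E x -> E y -> E (x - y).
Proof.
by move=> sE Ex Ey; rewrite -scaleN1r; apply: subspaceD => //; apply: subspaceZ.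
Qed.

Definition span n (b : 'I_n -> V) : set V :=
  [set x | exists c : 'I_n -> K, x = \sum_(i < n) c i *: b i].

Lemma subspace_span n (b : 'I_n -> V) : subspace (span b).
Proof.
apply/subspaceP; split=> [|a _ _ [c ->] [d ->]].
  by exists (fun=> 0); rewrite big1// => i _; rewrite scale0r.
exists (fun i => a * c i + d i); rewrite scaler_sumr -big_split /=.
by apply: eq_bigr => i _; rewrite scalerDl scalerA.
Qed.

Lemma subspace_setI E E' : subspace E -> subspace E' -> subspace (E `&` E').
Proof.
move=> /subspaceP[E0 El] /subspaceP[E'0 E'l]; apply/subspaceP; split=> //.
by move=> a x y [? ?] [? ?]; split; [exact: El|exact: E'l].
Qed.

(** This is E + K v, in the form used by [codimension_one]. *)
Definition adjoin E (v : V) : set V := [set x | exists a, E (x - a *: v)].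

Lemma subspace_adjoin E v : subspace E -> subspace (adjoin E v).
Proof.
move=> sE; apply/subspaceP; split=> [|a x y [b Ex] [c Ey]].
  by exists 0; rewrite scale0r subr0; exact: subspace0.
exists (a * b + c).
rewrite scalerDl -scalerA opprD addrACA -scalerBr.
by apply: subspaceD => //; exact: subspaceZ.
Qed.

Lemma sub_adjoin E v : E `<=` adjoin E v.
Proof. by move=> x Ex; exists 0; rewrite scale0r subr0. Qed.

Lemma finite_dimensional_adjoin E v :
  finite_dimensional E -> finite_dimensional (adjoin E v).
Proof.
(* The new family is [b] on the first n indices and [v] at [ord_max]. *)
move=> [n [b ->]]; exists n.+1, (fun i => oapp b v (unlift ord_max i)).
apply/seteqP; split=> [x [a [c xE]]|x [c ->]].
  exists (fun i => oapp c a (unlift ord_max i)).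
  rewrite big_ord_recr /= unlift_none /= -[x](subrK (a *: v)) xE; congr (_ + _).
  by apply: eq_bigr => i _; rewrite -lift_max_widen liftK.
exists (c ord_max), (fun i => c (lift ord_max i)).
rewrite big_ord_recr /= unlift_none /= addrK; apply: eq_bigr => i _.
by rewrite -lift_max_widen liftK.
Qed.

(* A subspace of the span of b_0, ..., b_n is its intersection with the span of
   b_0, ..., b_(n-1), to which at most one vector is adjoined. *)
Lemma subspace_ind (P : set V -> Prop) :
  P [set 0] ->
  (forall E v, subspace E -> ~ E v -> P E -> P (adjoin E v)) ->
  forall E B, subspace E -> finite_dimensional B -> E `<=` B -> P E.
Proof.
move=> P0 PS E B sE [n [b ->]] {B}.
rewrite -/(span b); elim: n b E sE => [|n IH] b E sE Eb.
  rewrite (_ : E = [set 0])//; apply/seteqP; split=> [x /Eb [c]|_ ->].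
    by rewrite big_ord0.
  exact: subspace0.
pose b' i := b (widen_ord (leqnSn n) i).
have spanS x : span b x -> exists c, span b' (x - c *: b ord_max).
  move=> [c ->]; exists (c ord_max), (fun i => c (widen_ord (leqnSn n) i)).
  by rewrite big_ord_recr /= addrK.
have sE0 := subspace_setI sE (subspace_span b').
have PE0 : P (E `&` span b') by apply: (IH b') => // x [].
have [EE0|/existsNP[v /not_implyP[Ev nE0v]]] :=
  pselect (forall v, E v -> (E `&` span b') v).
  by rewrite (_ : E = E `&` span b')//; apply/seteqP; split=> // x [].
rewrite (_ : E = adjoin (E `&` span b') v); first exact: PS.
apply/seteqP; split=> [x Ex|x [a [Exv _]]]; last first.
  by rewrite -[x](subrK (a *: v)); apply: subspaceD => //; exact: subspaceZ.
have [c vc] := spanS _ (Eb _ Ev); have [d xd] := spanS _ (Eb _ Ex).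
have c0 : c != 0.
  apply: contra_notN nE0v => /eqP c0.
  by split=> //; move: vc; rewrite c0 scale0r subr0.
(* Subtracting [(d / c) *: v] cancels the [b ord_max] component of [x]. *)
exists (d / c); split; first by apply: subspaceB => //; exact: subspaceZ.
rewrite (_ : _ - _ = (x - d *: b ord_max) - (d / c) *: (v - c *: b ord_max)).
  apply: subspaceB => //; first exact: subspace_span.
  by apply: subspaceZ => //; exact: subspace_span.
by rewrite scalerBr scalerA divfK// opprB addrA addrAC [RHS]addrAC subrK.
Qed.

Lemma finite_dimensional_set0 : finite_dimensional [set (0 : V)].
Proof.
exists 0%N, (fun=> 0); apply/seteqP; split=> [_ ->|x [c ->]] /=.
  by exists (fun=> 0); rewrite big_ord0.
by rewrite big_ord0.
Qed.

Lemma finite_dimensional_sub E E' : subspace E -> finite_dimensional E' ->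
  E `<=` E' -> finite_dimensional E.
Proof.
move=> sE fE' EE'; apply: (subspace_ind _ _ sE fE' EE').
  exact: finite_dimensional_set0.
by move=> {EE' sE}E v _ _; exact: finite_dimensional_adjoin.
Qed.

End LinearAlgebra.

Lemma subspace_range (K : numFieldType) (V W : lmodType K)
    (J : {linear V -> W}) :
  subspace (range J).
Proof.
apply/subspaceP; split=> [|a _ _ [x _ <-] [y _ <-]].
  by exists 0; rewrite ?raddf0.
by exists (a *: x + y); rewrite ?linearP.
Qed.

Section LinearOn.
Variables (K : numFieldType) (V W : lmodType K) (E : set V) (T : V -> W).
Hypotheses (sE : subspace E) (TE : linear_on E T).

Lemma linear_on0 : T 0 = 0.
Proof.
have E0 := subspace0 sE; have := TE 1 E0 E0; rewrite !scale1r addr0.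
by move=> /(congr1 (fun z => z - T 0)); rewrite subrr addrK.
Qed.

Lemma linear_onD x y : E x -> E y -> T (x + y) = T x + T y.
Proof. by move=> Ex Ey; have := TE 1 Ex Ey; rewrite !scale1r. Qed.

Lemma linear_onZ a x : E x -> T (a *: x) = a *: T x.
Proof.
move=> Ex; have := TE a Ex (subspace0 sE).
by rewrite linear_on0 !addr0.
Qed.

Lemma linear_onB x y : E x -> E y -> T (x - y) = T x - T y.
Proof.
move=> Ex Ey; rewrite -scaleN1r linear_onD ?linear_onZ ?scaleN1r//.
by rewrite -scaleN1r; exact: subspaceZ.
Qed.

End LinearOn.

(** Induction on E: adjoining v to E adjoins T v to the image. *)
Lemma finite_dimensional_image (K : numFieldType) (V W : lmodType K)
    (E : set V) (T : V -> W) :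
  subspace E -> linear_on E T -> finite_dimensional E ->
  finite_dimensional (T @` E).
Proof.
move=> sE TE fE; move: T TE.
apply: (subspace_ind (P := fun E => forall T : V -> W, linear_on E T ->
  finite_dimensional (T @` E)) _ _ sE fE (@subset_refl _ E)).
  move=> T TE; rewrite image_set1 (linear_on0 _ TE).
    exact: finite_dimensional_set0.
  apply/subspaceP; split=> // a x y -> -> /=.
  by rewrite scaler0 addr0.
move=> {fE}E v {}sE _ IH T TE.
have sEv := subspace_adjoin v sE.
have vEv : adjoin E v v by exists 1; rewrite scale1r subrr; exact: subspace0.
have EEv := @sub_adjoin _ _ E v.
rewrite (_ : T @` adjoin E v = adjoin (T @` E) (T v)).
  apply/finite_dimensional_adjoin/IH => a x y Ex Ey.
  by apply: TE; exact: EEv.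
apply/seteqP; split=> [_ [x [a Ex] <-]|z [a [x Ex Exz]]].
  exists a, (x - a *: v) => //.
  have xv : adjoin E v x by exists a.
  rewrite (linear_onB sEv TE xv) ?(linear_onZ sEv TE)//; exact: subspaceZ.
exists (a *: v + x); last first.
  by rewrite TE//; [rewrite Exz addrC subrK|exact: EEv].
by exists a; rewrite addrC addKr.
Qed.

(** * Completeness of finite-dimensional subspaces and of isometric copies *)

Lemma cauchy_ex_lipschitz (K : numFieldType)
    (V W : pseudoMetricNormedZmodType K) (S : set V) (f : V -> W) (M : K)
    (G : set_system V) :
  0 < M -> (forall x y, S x -> S y -> `|f x - f y| <= M * `|x - y|) ->
  ProperFilter G -> G S -> cauchy_ex G -> cauchy_ex (f @ G).
Proof.
move=> M0 fM GF GS GC e e0.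
have d0 : 0 < e / M / 2 by rewrite !divr_gt0.
have [x Gx] := GC _ d0.
(* The centre [x] may lie outside [S], where [f] is not controlled; moving it to [y] in [S] costs
   the factor 2 in the radius. *)
have [y [xy Sy]] := filter_ex (filterI Gx GS).
exists (f y); apply: (@filterS _ G _ _ _ _ (filterI Gx GS)) => z [xz Sz].
rewrite /preimage /= -ball_normE /=.
apply: (le_lt_trans (fM _ _ Sy Sz)); rewrite mulrC -ltr_pdivlMr//.
rewrite -ball_normE /= in xy xz.
rewrite [ltRHS]splitr -(subrKA x) (le_lt_trans (ler_normD _ _))//.
by rewrite ltrD// distrC.
Qed.

Section CompleteSets.
Variables (K : numFieldType) (V : normedModType K).

(** Stated through filters on V that contain E, so that no uniform structure on a subtype is
    needed. *)
Definition complete_set (E : set V) : Prop :=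
  forall G : set_system V, ProperFilter G -> G E -> cauchy_ex G ->
  exists2 l, E l & G --> l.

Lemma complete_set0 : complete_set [set 0].
Proof.
move=> G GF G0 _; exists 0 => // A A0.
by apply: filterS G0 => _ ->; exact: nbhs_singleton.
Qed.

(** The trace on E of the neighbourhoods of an adherent point p is Cauchy, and its limit in E must
    be p. *)
Lemma complete_set_closed (E : set V) : complete_set E -> closed E.
Proof.
move=> cE p Ep.
pose G : set_system V := within E (nbhs p).
have GF : ProperFilter G by apply: within_nbhs_proper.
have Gp : G --> p by exact: cvg_within.
have [|e e0|l El Gl] := cE G GF; first exact: withinT.
  by exists p; apply: Gp; exact: nbhsx_ballx.
by rewrite (cvg_unique (@norm_hausdorff _ V) Gp Gl).
Qed.

Variable E : set V.
Hypotheses (sE : subspace E) (cE : complete_set E) (v : V) (Ev : ~ E v).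

(** E is closed, so some ball of radius d around v misses E; dividing a v + e by a reduces the bound
    to this. *)
Lemma complete_set_dist :
  exists2 d : K, 0 < d & forall a e, E e -> d * `|a| <= `|a *: v + e|.
Proof.
have : nbhs v (~` E).
  apply: open_nbhs_nbhs; split=> //.
  by apply: closed_openC; exact: complete_set_closed.
move=> /nbhs_ballP[d /= d0 vd]; exists d => // a e Ee.
have [->|a0] := eqVneq a 0; first by rewrite normr0 mulr0.
rewrite -ler_pdivlMr ?normr_gt0// -normfV mulrC -normrZ.
rewrite scalerDr scalerA mulVf// scale1r.
rewrite real_leNgt ?normr_real ?gtr0_real//; apply/negP => ve.
apply: (vd (- (a^-1 *: e))); last first.
  by rewrite -scaleN1r scalerA; exact: subspaceZ.
by rewrite -ball_normE /= opprK.
Qed.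

(** The coefficient of v in the direct sum of E and K v, unique because v is outside E; the value
    off that sum is the default 0. *)
Definition coordinate (x : V) : K := xget 0 [set a | E (x - a *: v)].

Lemma coordinateP x : adjoin E v x -> E (x - coordinate x *: v).
Proof. by move=> [a Ea]; rewrite /coordinate; case: xgetP => //= /(_ a). Qed.

Lemma coordinateE a x : E (x - a *: v) -> coordinate x = a.
Proof.
move=> Exa; have /coordinateP Exb : adjoin E v x by exists a.
apply/eqP; rewrite -subr_eq0; apply: contra_notT Ev => ba.
rewrite -[v]scale1r -(mulVf ba) -scalerA; apply: subspaceZ => //.
rewrite scalerBl -(subrKA x) -[_ - x]opprB addrC; exact: subspaceB.
Qed.

Lemma coordinate_linear : linear_on (adjoin E v) (coordinate : V -> K^o).
Proof.
move=> a x y /coordinateP Ex /coordinateP Ey.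
apply: (@coordinateE (a * coordinate x + coordinate y)).
rewrite scalerDl -scalerA opprD addrACA -scalerBr.
by apply: subspaceD => //; exact: subspaceZ.
Qed.

(** By [complete_set_dist] both components of E (+) K v are Lipschitz, so a Cauchy filter converges
    componentwise, in K and in E. *)
Lemma complete_set_adjoin : complete_field K -> complete_set (adjoin E v).
Proof.
move=> Kc G GF GEv GC; have [d d0 dE] := complete_set_dist.
have sEv := subspace_adjoin v sE.
have coord_lip x y : adjoin E v x -> adjoin E v y ->
    `|coordinate x - coordinate y| <= d^-1 * `|x - y|.
  move=> Ex Ey; rewrite -(linear_onB sEv coordinate_linear)//.
  rewrite ler_pdivlMl//; have /coordinateP := subspaceB sEv Ex Ey.
  by move=> /(dE (coordinate (x - y))); rewrite [_ *: _ + _]addrC subrK.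
pose f x := x - coordinate x *: v.
have f_lip x y : adjoin E v x -> adjoin E v y ->
    `|f x - f y| <= (1 + d^-1 * `|v|) * `|x - y|.
  move=> Ex Ey; rewrite /f opprD addrACA -opprD -scalerBl.
  rewrite (le_trans (ler_normB _ _))// mulrDl mul1r lerD2l normrZ mulrAC.
  by rewrite ler_wpM2r// coord_lip.
have dV0 : 0 < d^-1 by rewrite invr_gt0.
have M0 : 0 < 1 + d^-1 * `|v| by rewrite ltr_pwDl// mulr_ge0// ltW.
have [a Ga] : exists a : K, coordinate @ G --> a.
  exact/Kc/(cauchy_ex_lipschitz dV0 coord_lip).
have [||e Ee Ge] := cE (G := f @ G).
- apply: (@filterS _ G _ _ _ _ GEv) => x; exact: coordinateP.
- exact: (cauchy_ex_lipschitz M0 f_lip).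
exists (e + a *: v); first by exists a; rewrite addrK.
rewrite (_ : G = (fun x => f x + coordinate x *: v) @ G).
  by apply: cvgD => //; apply: cvgZr_tmp.
rewrite (_ : (fun x => _) = id); first by rewrite /fmap.
by apply/funext => x; rewrite /f subrK.
Qed.

End CompleteSets.

Lemma finite_dimensional_complete (K : numFieldType) (V : normedModType K)
    (E : set V) :
  complete_field K -> subspace E -> finite_dimensional E -> complete_set E.
Proof.
move=> Kc sE fE.
apply: (subspace_ind _ _ sE fE (@subset_refl _ E)); first exact: complete_set0.
by move=> {fE}E v {}sE Ev cE; exact: complete_set_adjoin.
Qed.

(** The inverse of J is 1-Lipschitz on the range, so a Cauchy filter can be pulled back to X, where
    it converges. *)
Lemma complete_isometric_range (K : numFieldType) (X : completeNormedModType K)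
    (Z : normedModType K) (J : {linear X -> Z}) :
  isometry_on [set: X] J -> complete_set (range J).
Proof.
move=> Jiso G GF GJ GC.
pose f z := xget 0 [set x | J x = z].
have fJ z : range J z -> J (f z) = z.
  by move=> [x _ xz]; rewrite /f; case: xgetP => //= /(_ x).
have f_lip z w : range J z -> range J w -> `|f z - f w| <= 1 * `|z - w|.
  by move=> Rz Rw; rewrite mul1r -Jiso// raddfB /= !fJ.
have /cauchyP/cauchy_cvg/cvg_ex[l fl] :=
  cauchy_ex_lipschitz ltr01 f_lip GF GJ GC.
exists (J l); first by exists l.
apply/cvgrPdist_lt => e e0; move/cvgrPdist_lt/(_ _ e0) : fl => fl.
apply: (@filterS _ G _ _ _ _ (filterI GJ fl)) => z [Rz].
by rewrite -{2}(fJ _ Rz) -raddfB Jiso.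
Qed.

(** * Putting a norm on a module, and turning a subspace into a space *)

Record norm_axioms (K : numFieldType) (V : lmodType K) (N : V -> K) : Prop := {
  norm_axiomD : forall x y, N (x + y) <= N x + N y;
  norm_axiomZ : forall a x, N (a *: x) = `|a| * N x;
  norm_axiom0 : forall x, N x = 0 -> x = 0
}.

(** An alias of V indexed by [NP], from which instance inference recovers the norm N. *)
Definition renormed (K : numFieldType) (V : lmodType K) (N : V -> K)
  (NP : norm_axioms N) : Type := V.

HB.instance Definition _ (K : numFieldType) (V : lmodType K) (N : V -> K)
  (NP : norm_axioms N) := GRing.Lmodule.copy (renormed NP) V.

HB.instance Definition _ (K : numFieldType) (V : lmodType K) (N : V -> K)
    (NP : norm_axioms N) :=
  Lmodule_isNormed.Build K (renormed NP)
    (norm_axiomD NP) (norm_axiomZ NP) (norm_axiom0 NP).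

(** The Gurariy property quantifies over normed spaces, so a subspace has to become a type; [sE] is
    kept as a parameter for the module instance. *)
Definition subspace_of (K : numFieldType) (V : lmodType K) (E : set V)
  (sE : subspace E) : Type := {x : V | x \in E}.

Section SubspaceType.
Variables (K : numFieldType) (V : lmodType K) (E : set V) (sE : subspace E).

HB.instance Definition _ := [isSub of subspace_of sE for sval].
HB.instance Definition _ := [Choice of subspace_of sE by <:].
HB.instance Definition _ :=
  GRing.SubChoice_isSubLmodule.Build K V [in E] (subspace_of sE)
    (GRing.submod_closed_semi sE).

End SubspaceType.

Lemma subspace_norm_axioms (K : numFieldType) (V : normedModType K) (E : set V)
    (sE : subspace E) :
  norm_axioms (fun x : subspace_of sE => `|val x|).
Proof.
split=> [x y|a x|x /normr0_eq0 x0]; first by rewrite raddfD ler_normD.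
  by rewrite GRing.valZ normrZ.
by apply: val_inj; rewrite raddf0.
Qed.

Lemma finite_dimensional_subspace_of (K : numFieldType) (V : lmodType K)
    (E : set V) (sE : subspace E) :
  finite_dimensional E -> finite_dimensional [set: subspace_of sE].
Proof.
move=> [n [b Eb]].
have bE i : b i \in E.
  rewrite inE Eb; exists (fun j => (j == i)%:R).
  rewrite (bigD1 i)//= eqxx scale1r big1 ?addr0//.
  by move=> j /negPf ->; rewrite scale0r.
exists n, (fun i => Sub (b i) (bE i)); apply/seteqP; split=> // x _.
have : E (val x) by have := valP x; rewrite inE.
rewrite {1}Eb => -[c xc]; exists c; apply: val_inj; rewrite xc raddf_sum.
by apply: eq_bigr => i _; rewrite [RHS]GRing.valZ SubK.
Qed.

(** * From the Gurariy property to almost isometric ideals *)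

Lemma gurariy_ai_ideal (K : numFieldType) (X : completeNormedModType K) :
  gurariy X -> ai_ideal_in_hyperplane_superspaces X.
Proof.
move=> gX Z J Jiso cJ _; split=> //; first exact: subspace_range.
move=> eps E eps0 fE.
have sE : subspace E by case: (fE) => n [b ->]; exact: subspace_span.
pose F : normedModType K := renormed (subspace_norm_axioms sE).
pose vl (x : F) : Z := \val (x : subspace_of sE).
(* The partial inverse of [J], with default 0 outside its range. *)
pose T (x : F) : X := xget 0 [set y | J y = vl x].
have JT x : range J (vl x) -> J (T x) = vl x.
  by move=> [y _ yx]; rewrite /T; case: xgetP => //= /(_ y).
have Jinj : injective J.
  move=> x y /eqP; rewrite -subr_eq0 -raddfB -normr_eq0 Jiso// normr_eq0.
  by rewrite subr_eq0 => /eqP.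
pose E' : set F := [set x | range J (vl x)].
have vlP a x y : vl (a *: x + y) = a *: vl x + vl y by rewrite /vl linearP.
have [||||T' [T'T T'eps]] := gX eps F E' T eps0.
- exact: (finite_dimensional_subspace_of sE fE).
- apply/subspaceP; split=> [|a x y [u _ ux] [w _ wy]].
    by exists 0; rewrite // raddf0 /vl raddf0.
  by exists (a *: u + w); rewrite // vlP linearP ux wy.
- move=> a x y Ex Ey; apply: Jinj; rewrite JT ?linearP ?JT//.
  move: Ex Ey => [u _ ux] [w _ wy]; exists (a *: u + w) => //.
  by rewrite vlP linearP ux wy.
- by move=> x Ex; rewrite -Jiso// JT.
(* [insubd] replaces vectors outside [E] by 0, which makes [U] total. *)
pose U (z : Z) : Z := J (T' (insubd 0 z : subspace_of sE)).
have UE (x : F) : U (vl x) = J (T' x) by rewrite /U /vl valKd.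
have vlE z : E z -> exists x : F, vl x = z.
  by move=> /mem_set Ez; exists (Sub z Ez : subspace_of sE); rewrite /vl SubK.
exists U; split.
- move=> a _ _ /vlE[x <-] /vlE[y <-]; by rewrite -vlP !UE !linearP.
- by move=> z _; exists (T' (insubd 0 z : subspace_of sE)).
- by move=> z Yz /vlE[x xz]; rewrite -xz UE T'T ?JT//= /E' /= xz.
- by move=> _ /vlE[x <-]; rewrite UE Jiso//; exact: T'eps.
Qed.

(** * Infima and the pushout norm on X (+) K *)

Section Infimum.
Variables (K : numFieldType) (Kinf : has_infima K).

Definition infimum (A : set K) : K :=
  xget 0 [set m | (forall x, A x -> m <= x) /\
                  (forall l, (forall x, A x -> l <= x) -> l <= m)].

Lemma infimumP (A : set K) : A !=set0 -> (forall x, A x -> 0 <= x) ->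
  (forall x, A x -> infimum A <= x) /\
  (forall l, (forall x, A x -> l <= x) -> l <= infimum A).
Proof.
move=> A0 Age0; rewrite /infimum; case: xgetP => [m _ //|nm].
by have [m mP] := Kinf A0 Age0; case: (nm m).
Qed.

End Infimum.

Section PushoutNorm.
Variables (K : numFieldType) (X F : normedModType K).
Variables (E : set F) (T : F -> X) (C : K) (v : F).

(* X x K stands for the quotient of X (+) (E + K v) by the graph of - T. *)
Definition pushout_values (z : X * K^o) : set K :=
  [set r | exists2 e, E e & r = `|z.1 + T e| + C * `|z.2 *: v - e|].

Definition pushout_norm (z : X * K^o) : K := infimum (pushout_values z).

Hypotheses (Kinf : has_infima K) (sE : subspace E) (TE : linear_on E T).
Hypothesis C0 : 0 < C.

Lemma pushout_norm_le z e :
  E e -> pushout_norm z <= `|z.1 + T e| + C * `|z.2 *: v - e|.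
Proof.
move=> Ee; have [|x [f _ ->]|h _] := @infimumP _ Kinf (pushout_values z).
- by exists (`|z.1 + T 0| + C * `|z.2 *: v - 0|), 0 => //; exact: subspace0.
- by rewrite addr_ge0 ?mulr_ge0// ltW.
- by apply: h; exists e.
Qed.

Lemma le_pushout_norm z l :
  (forall e, E e -> l <= `|z.1 + T e| + C * `|z.2 *: v - e|) ->
  l <= pushout_norm z.
Proof.
move=> lz; have [|x [f _ ->]|_] := @infimumP _ Kinf (pushout_values z).
- by exists (`|z.1 + T 0| + C * `|z.2 *: v - 0|), 0 => //; exact: subspace0.
- by rewrite addr_ge0 ?mulr_ge0// ltW.
- by apply=> _ [e Ee ->]; exact: lz.
Qed.

Hypothesis TC : forall e, E e -> `|T e| <= C * `|e|.

(** Taking e = 0 gives one inequality; the other is the triangle inequality with |T e| <= C |e|. *)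
Lemma pushout_normX (x : X) : pushout_norm (x, 0) = `|x|.
Proof.
apply/eqP; rewrite eq_le; apply/andP; split.
  have := pushout_norm_le (x, 0) (subspace0 sE).
  by rewrite /= (linear_on0 sE TE) scale0r subr0 normr0 mulr0 !addr0.
apply: le_pushout_norm => e Ee /=; rewrite scale0r sub0r normrN.
rewrite -{1}[x](addrK (T e)) (le_trans (ler_normB _ _))// lerD2l.
exact: TC.
Qed.

(** The upper bound is the value at -e. For the lower one, e + a v splits as (e + f) + (a v - f): T
    shrinks the first term by at most C^-1, and C^-1 <= C handles the second. *)
Lemma pushout_norm_adjoin e a : E e ->
  C^-1 <= C -> (forall f, E f -> C^-1 * `|f| <= `|T f|) ->
  C^-1 * `|e + a *: v| <= pushout_norm (T e, a) /\
  pushout_norm (T e, a) <= C * `|e + a *: v|.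
Proof.
move=> Ee CVC CT; split; last first.
  have := pushout_norm_le (T e, a) (subspaceZ (-1) sE Ee).
  rewrite /= (linear_onZ sE TE)// scaleN1r subrr normr0 add0r.
  by rewrite scaleN1r opprK [_ *: v + e]addrC.
apply: le_pushout_norm => f Ef /=.
rewrite -(linear_onD TE)//.
rewrite (_ : e + a *: v = (e + f) + (a *: v - f)); last first.
  by rewrite addrACA subrr addr0.
apply: (@le_trans _ _ (C^-1 * `|e + f| + C^-1 * `|a *: v - f|)).
  by rewrite -mulrDr ler_wpM2l ?ler_normD// invr_ge0 ltW.
by rewrite lerD ?CT ?ler_wpM2r//; exact: subspaceD.
Qed.

Hypothesis vE :
  exists2 d : K, 0 < d & forall a e, E e -> d * `|a| <= `|a *: v + e|.

(** Definiteness rests on the positive distance from v to E: the norm of (x, a) is at least C d |a|,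
    so a null vector has a = 0, and then x = 0. *)
Lemma pushout_norm_axioms : norm_axioms pushout_norm.
Proof.
have N0 : pushout_norm 0 = 0 by rewrite pushout_normX normr0.
(* Half of homogeneity suffices: applied to [a^-1] it yields the other half. *)
have NZle a x : a != 0 -> pushout_norm (a *: x) <= `|a| * pushout_norm x.
  move=> a0; rewrite -ler_pdivrMl ?normr_gt0//; apply: le_pushout_norm => e Ee.
  rewrite ler_pdivrMl ?normr_gt0//.
  have := pushout_norm_le (a *: x) (subspaceZ a sE Ee).
  rewrite (linear_onZ sE TE)//= -scalerA -scalerDr -scalerBr !normrZ.
  by rewrite mulrCA -mulrDr.
split=> [x y|a x|[x a] xa0].
(* The two infima are removed one after the other; e and f are then combined into the competitor e +
   f. *)
- rewrite -lerBlDr; apply: le_pushout_norm => e Ee.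
  rewrite lerBlDr [leRHS]addrC -lerBlDr; apply: le_pushout_norm => f Ef.
  rewrite lerBlDr (le_trans (pushout_norm_le _ (subspaceD sE Ee Ef)))//=.
  rewrite (linear_onD TE)// [leRHS]addrC [leRHS]addrACA -mulrDr lerD//.
    by rewrite addrACA ler_normD.
  rewrite ler_wpM2l ?(ltW C0)// scalerDl opprD addrACA.
  by rewrite ler_normD.
- have [->|a0] := eqVneq a 0; first by rewrite scale0r N0 normr0 mul0r.
  apply/eqP; rewrite eq_le NZle//= -ler_pdivlMl ?normr_gt0// -normfV.
  have := @NZle a^-1 (a *: x); rewrite invr_eq0 => /(_ a0).
  by rewrite scalerA mulVf// scale1r.
have [d d0 dE] := vE.
have a0 : a = 0.
  apply/eqP; rewrite -normr_le0 -(pmulr_rle0 _ (mulr_gt0 C0 d0)) -xa0.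
  apply: le_pushout_norm => e Ee /=; rewrite ler_wpDl// -mulrA.
  rewrite ler_wpM2l ?(ltW C0)//; apply: dE.
  by rewrite -scaleN1r; exact: subspaceZ.
move: xa0; rewrite a0 pushout_normX => /normr0_eq0 ->.
by [].
Qed.

End PushoutNorm.

(** * Extending eps-isometries one vector at a time *)

Lemma ai_ideal_hyperplane (K : numFieldType) (X : completeNormedModType K)
    (Z : normedModType K) (J : {linear X -> Z}) (w : Z) :
  complete_field K -> ai_ideal_in_hyperplane_superspaces X ->
  isometry_on [set: X] J -> ~ range J w ->
  (forall z, exists a : K, range J (z - a *: w)) ->
  forall (eps : K) (E : set Z), 0 < eps -> finite_dimensional E ->
    exists T : Z -> Z,
      [/\ linear_on E T, forall e, E e -> range J (T e),
          forall e, range J e -> E e -> T e = e & eps_isometry_on eps E T].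
Proof.
move=> Kc Xai Jiso Jw JZ.
have cJ := complete_isometric_range Jiso.
have sJ := subspace_range J.
(* [Z] is the complete range of [J] with [w] adjoined, hence a Banach space to which the hypothesis
   on [X] applies. *)
have cZ (G : set_system Z) : ProperFilter G -> cauchy G -> cvg G.
  move=> GF /cauchyP GC; apply/cvg_ex.
  have [|l _ Gl] := complete_set_adjoin sJ cJ Jw Kc GF _ GC; last by exists l.
  by apply: filterS filterT => z _; exact: JZ.
pose Zc : completeNormedModType K :=
  HB.pack_for (completeNormedModType K) (NormedModule.sort Z)
    (Uniform_isComplete.Build Z cZ).
have [|_ _] // := Xai Zc J Jiso (complete_set_closed cJ).
by exists w => // z; have [a za] := JZ z; exists a.
Qed.

Lemma eps_isometry_extension_step (K : numFieldType)
    (X : completeNormedModType K) (F : normedModType K) (E : set F) (v : F)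
    (T : F -> X) (eps eps' : K) :
  complete_field K -> has_infima K -> ai_ideal_in_hyperplane_superspaces X ->
  subspace E -> finite_dimensional E -> ~ E v -> 0 <= eps -> eps < eps' ->
  linear_on E T -> eps_isometry_on eps E T ->
  exists T' : F -> X, [/\ linear_on (adjoin E v) T',
    forall e, E e -> T' e = T e & eps_isometry_on eps' (adjoin E v) T'].
Proof.
move=> Kc Kinf Xai sE fE Ev eps0 eps'E TE Teps.
have C0 : 0 < 1 + eps by rewrite ltr_wpDr.
have C1 : 1 <= 1 + eps by rewrite lerDl.
have CV1 : (1 + eps)^-1 <= 1 by rewrite invf_le1.
have cE := finite_dimensional_complete Kc sE fE.
have dist := complete_set_dist sE cE Ev.
have T_le e : E e -> `|T e| <= (1 + eps) * `|e| by move=> /Teps[].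
have T_ge e : E e -> (1 + eps)^-1 * `|e| <= `|T e| by move=> /Teps[].
pose Z : normedModType K :=
  renormed (pushout_norm_axioms Kinf sE TE C0 T_le dist).
have J_lin : linear (fun x : X => (x, 0) : Z).
  by move=> a x y; congr (_, _); rewrite /= scaler0 addr0.
pose J : {linear X -> Z} := HB.pack (fun x : X => (x, 0) : Z)
  (GRing.isLinear.Build K X Z *:%R _ J_lin).
have Jiso : isometry_on [set: X] J.
  by move=> x _; exact: (pushout_normX v Kinf sE TE C0 T_le x).
have rangeJ (z : Z) : range J z <-> z.2 = 0.
  by split=> [[x _ <-]//|]; case: z => x a /= ->; exists x.
have Jw : ~ range J ((0, 1) : Z) by move=> /rangeJ /eqP; rewrite oner_eq0.
have JZ (z : Z) : exists a : K, range J (z - a *: ((0, 1) : Z)).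
  exists z.2; apply/rangeJ; case: z => x a /=.
  by rewrite [_ *: _]mulr1 subrr.
(* On [adjoin E v] this is the map e + a v |-> (T e, a). *)
pose S (x : F) : Z := (T (x - coordinate E v x *: v), coordinate E v x).
have sEv := subspace_adjoin v sE.
have S_lin : linear_on (adjoin E v) S.
  move=> a x y Ex Ey; have := coordinate_linear sE Ev a Ex Ey => cxy.
  congr (_, _) => //; rewrite cxy -TE; try exact: coordinateP.
  congr (T _); rewrite scalerDl opprD addrACA scalerBr; congr (_ - _ + _).
  by rewrite scalerA.
have S_eps : eps_isometry_on eps (adjoin E v) S.
  move=> x Ex; have := pushout_norm_adjoin v Kinf sE TE C0 (coordinate E v x)
    (coordinateP Ex) (le_trans CV1 C1) T_ge.
  by rewrite subrK.
have SE e : E e -> S e = J (T e).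
  move=> Ee; rewrite /S (_ : coordinate E v e = 0) ?scale0r ?subr0//.
  by apply: (coordinateE sE Ev); rewrite scale0r subr0.
(* Chosen so that one plus this constant, times 1 + eps, is 1 + eps'. *)
have d0 : 0 < (eps' - eps) / (1 + eps) by rewrite divr_gt0// subr_gt0.
have fS := finite_dimensional_image sEv S_lin (finite_dimensional_adjoin v fE).
have [U [U_lin UJ UE Ueps]] := ai_ideal_hyperplane Kc Xai Jiso Jw JZ d0 fS.
have SEv x : adjoin E v x -> (S @` adjoin E v) (S x) by exists x.
(* [U] takes its values in the copy of [X], so the first component undoes [J]. *)
have JUS x : adjoin E v x -> J (U (S x)).1 = U (S x).
  move=> /SEv /UJ /rangeJ; case: (U (S x)) => y b /= ->.
  by [].
exists (fun x => (U (S x)).1); split=> [a x y Ex Ey|e Ee|x Ex].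
- by rewrite S_lin// U_lin//; exact: SEv.
- have -> : U (S e) = S e; last by rewrite SE.
  apply: UE; first by rewrite SE//; exists (T e).
  by apply: SEv; exact: sub_adjoin.
have -> : `|(U (S x)).1| = `|U (S x)| by rewrite -{2}(JUS _ Ex) Jiso.
have [S1 S2] := S_eps _ Ex; have [U1 U2] := Ueps _ (SEv _ Ex).
have CC : (1 + (eps' - eps) / (1 + eps)) * (1 + eps) = 1 + eps'.
  by rewrite mulrDl mul1r divfK ?gt_eqF//; ring.
split.
  rewrite -CC invfM -mulrA; apply: le_trans U1; rewrite ler_wpM2l// invr_ge0.
  by rewrite addr_ge0// ltW.
rewrite -CC -mulrA; apply: (le_trans U2); rewrite ler_wpM2l//.
by rewrite addr_ge0// ltW.
Qed.

(** Induction on the number n of vectors that span F modulo E: the last one is dropped if it lies in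
    E and adjoined to E otherwise. *)
Lemma eps_isometry_extension (K : numFieldType) (X : completeNormedModType K)
    (F : normedModType K) (n : nat) (b : 'I_n -> F) (E : set F)
    (T : F -> X) (eps eps' : K) :
  complete_field K -> has_infima K -> ai_ideal_in_hyperplane_superspaces X ->
  subspace E -> finite_dimensional E ->
  (forall x, exists c : 'I_n -> K, E (x - \sum_(i < n) c i *: b i)) ->
  0 <= eps -> eps < eps' -> linear_on E T -> eps_isometry_on eps E T ->
  exists T' : F -> X, [/\ linear_on [set: F] T',
    forall e, E e -> T' e = T e & eps_isometry_on eps' [set: F] T'].
Proof.
move=> Kc Kinf Xai.
elim: n b E T eps => [|n IH] b E T eps sE fE Eb eps0 lteps TE Teps.
  have ET x : E x by have [c] := Eb x; rewrite big_ord0 subr0.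
  exists T; split=> [a x y _ _|//|x _]; first exact: TE.
  have eps1 : 0 < 1 + eps by rewrite ltr_wpDr.
  have eps'1 : 0 < 1 + eps' by rewrite (lt_trans eps1)// ltrD2l.
  have [T1 T2] := Teps _ (ET x); split.
    by apply: le_trans T1; rewrite ler_wpM2r// lef_pV2// lerD2l ltW.
  by apply: (le_trans T2); rewrite ler_wpM2r// lerD2l ltW.
pose v := b ord_max; pose b' i := b (widen_ord (leqnSn n) i).
have [Ev|Ev] := pselect (E v).
  apply: (IH b' E T eps) => // x; have [c] := Eb x.
  rewrite big_ord_recr /= => Exc; exists (fun i => c (widen_ord (leqnSn n) i)).
  rewrite -[_ - _](subrK (c ord_max *: v)).
  by apply: subspaceD => //; [rewrite -addrA -opprD|exact: subspaceZ].
(* Stopping at the midpoint of eps and eps' leaves room for the remaining steps. *)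
have [lt1 lt2] := midf_lt lteps.
have [T1 [T1_lin T1E T1eps]] :=
  eps_isometry_extension_step Kc Kinf Xai sE fE Ev eps0 lt1 TE Teps.
have [||||T' [T'_lin T'E T'eps]] :=
  IH b' (adjoin E v) T1 ((eps + eps') / 2) _ _ _ _ lt2 T1_lin T1eps.
- exact: subspace_adjoin.
- exact: finite_dimensional_adjoin.
- move=> x; have [c] := Eb x.
  rewrite big_ord_recr /= => Exc; exists (fun i => c (widen_ord (leqnSn n) i)).
  by exists (c ord_max); rewrite -addrA -opprD.
- by rewrite (le_trans eps0)// ltW.
by exists T'; split=> // e Ee; rewrite T'E ?T1E//; exact: sub_adjoin.
Qed.

Lemma ai_ideal_gurariy (K : numFieldType) (X : completeNormedModType K) :
  complete_field K -> has_infima K ->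
  ai_ideal_in_hyperplane_superspaces X -> gurariy X.
Proof.
move=> Kc Kinf Xai eps F E T eps0 [n [b Fb]] sE TE Tiso.
have fE : finite_dimensional E.
  by apply: (finite_dimensional_sub sE (E' := [set: F])) => //; exists n, b.
have Eb x : exists c : 'I_n -> K, E (x - \sum_(i < n) c i *: b i).
  have : [set: F] x by [].
  rewrite Fb => -[c ->]; exists c; rewrite subrr; exact: subspace0.
(* The iteration starts from the isometry [T], with constant 0. *)
have T0 : eps_isometry_on 0 E T.
  by move=> x Ex; rewrite addr0 invr1 mul1r Tiso.
have [T' [T'_lin T'E T'eps]] :=
  eps_isometry_extension Kc Kinf Xai sE fE Eb (lexx 0) eps0 TE T0.
have T'_linear : linear T' by move=> a x y; exact: T'_lin.
by exists (HB.pack T' (GRing.isLinear.Build K F X *:%R T' T'_linear)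
  : {linear F -> X}).
Qed.

Theorem corollary4p3 (R : realType) :
  (forall X : completeNormedModType R,
     gurariy X <-> ai_ideal_in_hyperplane_superspaces X) /\
  (forall X : completeNormedModType (R[i])%C,
     gurariy X <-> ai_ideal_in_hyperplane_superspaces X).
Proof.
split=> X; split; try exact: gurariy_ai_ideal.
  exact/ai_ideal_gurariy/real_has_infima/real_complete_field.
exact/ai_ideal_gurariy/complex_has_infima/complex_complete_field.
Qed.
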